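(* Let $n\ge 0$ be an integer. The condition number of solving $M^n\mathbf{c}=\mathbf{b}$, measuring $\mathbf{c}$ in the $M^n$-norm and $\mathbf{b}$ in the Euclidean 2-norm, satisfies $$\kappa_{M^n\rightarrow 2}(M^n) = \sqrt{\kappa_2(M^n)} = \sqrt{\frac{(2n+1)!}{(n+1)!\,n!}}.$$
   Context: Matrix and vector indices run from $0$ to $n$. The Bernstein polynomials are $B^n_i(x)=\binom{n}{i}x^i(1-x)^{n-i}$, $0\le i\le n$, and the Bernstein mass matrix $M^n$ is the symmetric positive definite $(n+1)\times(n+1)$ matrix $M^n_{ij}=\int_0^1 B^n_i(x)B^n_j(x)\,dx$. For $\mathbf{c}\in\mathbb{R}^{n+1}$, $\|\mathbf{c}\|_{M^n}=\sqrt{\mathbf{c}^T M^n\mathbf{c}}$, and $\|\cdot\|_2$ is the Euclidean norm. For a real $(n+1)\times(n+1)$ matrix $A$ define $$\|A\|_{M^n\rightarrow 2}=\max_{\|\mathbf{c}\|_{M^n}=1}\|A\mathbf{c}\|_2,\qquad \|A\|_{2\rightarrow M^n}=\max_{\|\mathbf{c}\|_2=1}\|A\mathbf{c}\|_{M^n}.$$ For invertible $A$, $\kappa_{M^n\rightarrow 2}(A)=\|A\|_{M^n\rightarrow 2}\,\|A^{-1}\|_{2\rightarrow M^n}$, and $\kappa_2(A)=\|A\|_2\|A^{-1}\|_2$ is the usual 2-norm condition number. *)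

(* Defs.v *)
From mathcomp Require Import all_boot all_order all_algebra.
From mathcomp Require Import all_classical all_reals all_analysis.

Set Implicit Arguments.
Unset Strict Implicit.
Unset Printing Implicit Defensive.

Import Order.TTheory GRing.Theory Num.Theory.
Import numFieldNormedType.Exports.

Local Open Scope classical_set_scope.
Local Open Scope ring_scope.

Definition bernstein (R : realType) (n i : nat) (x : R) : R :=
  'C(n, i)%:R * x ^+ i * (1 - x) ^+ (n - i).

Definition mass_mx (R : realType) (n : nat) : 'M[R]_n.+1 :=
  \matrix_(i < n.+1, j < n.+1)
    \int[lebesgue_measure]_(x in `[0, 1]) (bernstein n i x * bernstein n j x).

(* The library norm [`|c|] of a matrix is the sup norm, hence this explicit
   Euclidean norm. *)
Definition norm2 (R : realType) (m : nat) (c : 'cV[R]_m) : R :=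
  Num.sqrt (\sum_(i < m) c i 0 ^+ 2).

Definition mass_norm (R : realType) (n : nat) (c : 'cV[R]_n.+1) : R :=
  Num.sqrt ((c^T *m mass_mx R n *m c) 0 0).

(* The greatest element of [S]; [0] is a default value used only when [S] has
   no greatest element. *)
Definition set_max (R : realType) (S : set R) : R := xget 0 (S `&` ubound S).

Definition op_norm (R : realType) (m : nat) (N1 N2 : 'cV[R]_m -> R)
    (A : 'M[R]_m) : R :=
  set_max [set N2 (A *m c) | c in [set c | N1 c = 1]].

(* Meaningful for [A \in unitmx]: [invmx A] is [A] itself otherwise. *)
Definition cond_num (R : realType) (m : nat) (N1 N2 : 'cV[R]_m -> R)
    (A : 'M[R]_m) : R :=
  op_norm N1 N2 A * op_norm N2 N1 (invmx A).

Definition kappa_mass2 (R : realType) (n : nat) (A : 'M[R]_n.+1) : R :=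
  cond_num (@mass_norm R n) (@norm2 R n.+1) A.

Definition kappa2 (R : realType) (m : nat) (A : 'M[R]_m) : R :=
  cond_num (@norm2 R m) (@norm2 R m) A.

(* Main.v *)
Require Import Defs.
From mathcomp Require Import all_boot all_order all_algebra.
From mathcomp Require Import all_classical all_reals all_analysis.
From mathcomp Require Import ring zify.

Set Implicit Arguments.
Unset Strict Implicit.
Unset Printing Implicit Defensive.

Import Order.TTheory GRing.Theory Num.Theory.
Import numFieldNormedType.Exports.

Local Open Scope classical_set_scope.
Local Open Scope ring_scope.

(** In an orthonormal eigenbasis of a symmetric positive definite matrix M
with eigenvalues l_i, all norms involved are weighted Euclidean norms of the
coordinates y of c:
  |c|^2 = sum y_i^2,          |M c|^2 = sum l_i^2 y_i^2,
  |c|_M^2 = sum l_i y_i^2,    |M^-1 c|_M^2 = sum l_i^-1 y_i^2,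
                              |M^-1 c|^2 = sum l_i^-2 y_i^2.
The operator norm between two such norms is the square root of the largest
ratio of weights ([op_norm_wnorm]).  Hence kappa_2(M) = l_max / l_min, while
the norm of M from the M-norm to the 2-norm is sqrt l_max and that of M^-1 in
the other direction is sqrt (1 / l_min): the mixed condition number is
sqrt (l_max / l_min) for every symmetric positive definite M.

What is specific to the Bernstein mass matrix is its spectrum
  l_k = n!^2 / ((n + k + 1)! (n - k)!),   0 <= k <= n.
It is found by looking at the monomials: C(n, k) x^k has Bernstein
coefficients C(j, k), and its inner product with B_i is a beta integral equal to
l_k C(i + k, k).  By Vandermonde's identity C(i + k, k) = sum_j C(k, j) C(i, j),
so, with P the Pascal matrix (C(i, j)) and D = diag (l_k), this reads
P^T M = (D P) P^T ([pascal_mass]).  Thus M is similar to the lower triangular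
matrix D P, whose diagonal entries are the l_k because P is unitriangular.
The l_k are strictly decreasing in k, hence distinct; this makes eigenvectors
of M orthogonal to each other and provides the eigenbasis ([sym_orthodiag]),
and it gives l_max = l_0 and l_min = l_n. *)

(** * Symmetric matrices with simple spectrum *)

(** Eigenvectors of a symmetric matrix for distinct eigenvalues are orthogonal,
so normalizing one eigenvector for each of m distinct eigenvalues gives an
orthonormal basis, the rows of [Q]. *)
Lemma sym_orthodiag (R : rcfType) (m : nat) (M : 'M[R]_m) (l : 'rV[R]_m) :
  M^T = M -> injective (l 0) -> (forall i, eigenvalue M (l 0 i)) ->
  exists2 Q : 'M[R]_m, Q *m Q^T = 1%:M & M = Q^T *m diag_mx l *m Q.
Proof.
move=> Msym l_inj Mev.
have /fin_all_exists[u uP] i : exists u : 'rV[R]_m,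
    u *m M = l 0 i *: u /\ (u *m u^T) 0 0 = 1.
  have /eigenvalueP[v vM v_neq0] := Mev i.
  have vv : (v *m v^T) 0 0 = \sum_j v 0 j ^+ 2.
    by rewrite mxE; apply: eq_bigr => j _; rewrite mxE.
  have vv_gt0 : 0 < (v *m v^T) 0 0.
    rewrite vv lt_def sumr_ge0 ?andbT => [|j _]; last exact: sqr_ge0.
    apply: contra v_neq0 => /eqP v0; apply/eqP/rowP => j; rewrite !mxE.
    apply/eqP; rewrite -sqrf_eq0 (psumr_eq0P _ v0)// => k _; exact: sqr_ge0.
  exists ((Num.sqrt ((v *m v^T) 0 0))^-1 *: v); split.
    by rewrite -scalemxAl vM !scalerA mulrC.
  rewrite linearZ /= -scalemxAl -scalemxAr scalerA mxE.
  by rewrite -invfM -expr2 sqr_sqrtr ?ltW// mulVf ?gt_eqF.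
pose Q : 'M[R]_m := \matrix_i u i.
have QQ i j : (Q *m Q^T) i j = (u i *m (u j)^T) 0 0.
  by rewrite !mxE; apply: eq_bigr => k _; rewrite !mxE.
have Qortho : Q *m Q^T = 1%:M.
  apply/matrixP => i j; rewrite QQ [RHS]mxE.
  have [->|ij] := eqVneq i j; first by case: (uP j).
  have [[uiM _] [ujM _]] := (uP i, uP j).
  (* u_i M u_j^T is l_i u_i u_j^T, and also l_j u_i u_j^T as M is symmetric *)
  have : l 0 i *: (u i *m (u j)^T) = l 0 j *: (u i *m (u j)^T).
    rewrite scalemxAl -uiM -mulmxA -[in LHS]Msym -trmx_mul ujM.
    by rewrite linearZ /= -scalemxAr.
  move=> /matrixP/(_ 0 0)/eqP; rewrite !mxE -subr_eq0 -mulrBl mulf_eq0 subr_eq0.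
  by rewrite (inj_eq l_inj) (negPf ij) => /eqP.
exists Q => //.
have -> : diag_mx l = Q *m M *m Q^T.
  have -> : Q *m M = diag_mx l *m Q.
    apply/row_matrixP => i; rewrite row_mul rowK; case: (uP i) => -> _.
    by apply/rowP => j; rewrite mul_diag_mx !mxE.
  by rewrite -mulmxA Qortho mulmx1.
by rewrite !mulmxA (mulmx1C Qortho) mul1mx -mulmxA (mulmx1C Qortho) mulmx1.
Qed.

(** * Operator norms between weighted Euclidean norms *)

Lemma set_max_eq (R : realType) (S : set R) (v : R) :
  S v -> ubound S v -> set_max S = v.
Proof.
move=> Sv ubv; apply: xget_unique => // w [Sw ubw].
by apply/eqP; rewrite eq_le ubv//= ubw.
Qed.

Definition wnorm (R : realType) (m : nat) (Q : 'M[R]_m) (w : 'I_m -> R)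
    (c : 'cV[R]_m) : R :=
  Num.sqrt (\sum_i w i * (Q *m c) i 0 ^+ 2).

(** If [r] bounds the ratio of the weights and is attained at index [k], then
the bound holds term by term, and it is attained at the [k]-th basis vector,
scaled to have norm 1. *)
Lemma op_norm_wnorm (R : realType) (m : nat) (Q A : 'M[R]_m)
    (N1 N2 : 'cV[R]_m -> R) (a b : 'I_m -> R) (r : R) (k : 'I_m) :
  Q *m Q^T = 1%:M ->
  (forall c, N1 c = wnorm Q a c) -> (forall c, N2 (A *m c) = wnorm Q b c) ->
  (forall i, 0 < a i) -> (forall i, b i <= r * a i) -> b k = r * a k ->
  op_norm N1 N2 A = Num.sqrt r.
Proof.
move=> QQ N1E N2E a_gt0 bra brk; apply: set_max_eq.
  pose c : 'cV[R]_m := (Num.sqrt (a k))^-1 *: (Q^T *m delta_mx k 0).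
  have Qc i : (Q *m c) i 0 ^+ 2 = (a k)^-1 *+ (i == k).
    rewrite -scalemxAr mulmxA QQ mul1mx !mxE eqxx andbT exprMn.
    rewrite exprVn sqr_sqrtr ?ltW//.
    by case: (i == k); rewrite ?expr1n ?mulr1// expr0n mulr0.
  have wc w : wnorm Q w c = Num.sqrt (w k / a k).
    rewrite /wnorm (bigD1 k)//= Qc eqxx mulr1n big1 ?addr0// => i /negPf ik.
    by rewrite Qc ik mulr0n mulr0.
  exists c => /=.
    by rewrite N1E wc divff ?sqrtr1 ?gt_eqF.
  by rewrite N2E wc brk mulfK ?gt_eqF.
move=> _ /= [c + <-]; rewrite N1E N2E /wnorm => c1.
have a1 : \sum_i a i * (Q *m c) i 0 ^+ 2 = 1.
  have a_ge0 : 0 <= \sum_i a i * (Q *m c) i 0 ^+ 2.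
    by apply: sumr_ge0 => i _; rewrite mulr_ge0 ?sqr_ge0 ?ltW.
  by rewrite -[LHS]sqr_sqrtr// c1 expr1n.
apply: ler_wsqrtr; rewrite -[r]mulr1 -a1 mulr_sumr; apply: ler_sum => i _.
by rewrite mulrA ler_wpM2r ?sqr_ge0.
Qed.

(** * Condition numbers of a diagonalized positive definite matrix *)

Section SpectralCondition.
Context (R : realType) (m : nat) (M Q : 'M[R]_m) (l : 'rV[R]_m).
Context (QQ : Q *m Q^T = 1%:M) (ME : M = Q^T *m diag_mx l *m Q).
Context (l_gt0 : forall i, 0 < l 0 i).

Let linv : 'rV[R]_m := \row_i (l 0 i)^-1.

Lemma orthodiag_coord (c : 'cV[R]_m) i :
  (Q *m (M *m c)) i 0 = l 0 i * (Q *m c) i 0.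
Proof. by rewrite ME !mulmxA QQ mul1mx -mulmxA mul_diag_mx mxE. Qed.

Lemma orthodiag_inv : invmx M = Q^T *m diag_mx linv *m Q.
Proof.
have MI : M *m (Q^T *m diag_mx linv *m Q) = 1%:M.
  rewrite ME !mulmxA -[_ *m Q *m Q^T]mulmxA QQ mulmx1.
  rewrite -[_ *m diag_mx l *m _]mulmxA.
  rewrite mulmx_diag (_ : \row_i _ = const_mx 1); last first.
    by apply/rowP => i; rewrite !mxE divff ?gt_eqF.
  by rewrite diag_const_mx mulmx1 (mulmx1C QQ).
have [Mu _] := mulmx1_unit MI.
by rewrite -[RHS](mulKmx Mu) MI mulmx1.
Qed.

Lemma orthodiag_inv_coord (c : 'cV[R]_m) i :
  (Q *m (invmx M *m c)) i 0 = (l 0 i)^-1 * (Q *m c) i 0.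
Proof.
by rewrite orthodiag_inv !mulmxA QQ mul1mx -mulmxA mul_diag_mx !mxE.
Qed.

Lemma norm2_wnorm (c : 'cV[R]_m) : norm2 c = wnorm Q (fun=> 1) c.
Proof.
have dotE (v : 'cV[R]_m) : \sum_i v i 0 ^+ 2 = (v^T *m v) 0 0.
  by rewrite mxE; apply: eq_bigr => i _; rewrite mxE.
rewrite /norm2 /wnorm dotE; under eq_bigr do rewrite mul1r.
by rewrite dotE trmx_mul -mulmxA (mulmxA _ Q) (mulmx1C QQ) mul1mx.
Qed.

Lemma norm2_mul_wnorm (c : 'cV[R]_m) :
  norm2 (M *m c) = wnorm Q (fun i => l 0 i ^+ 2) c.
Proof.
rewrite norm2_wnorm; congr Num.sqrt; apply: eq_bigr => i _.
by rewrite orthodiag_coord mul1r exprMn.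
Qed.

Lemma energy_wnorm (c : 'cV[R]_m) :
  Num.sqrt ((c^T *m M *m c) 0 0) = wnorm Q (l 0) c.
Proof.
congr Num.sqrt; rewrite ME !mulmxA -mulmxA -trmx_mul -mulmxA mul_diag_mx mxE.
by apply: eq_bigr => i _; rewrite !mxE mulrCA.
Qed.

Context (i0 i1 : 'I_m).
Context (l_max : forall i, l 0 i <= l 0 i0) (l_min : forall i, l 0 i1 <= l 0 i).

Lemma kappa2_orthodiag : kappa2 M = l 0 i0 / l 0 i1.
Proof.
have l_ge0 i : 0 <= l 0 i by rewrite ltW.
have MV2 c : norm2 (invmx M *m c) = wnorm Q (fun i => (l 0 i)^-1 ^+ 2) c.
  rewrite norm2_wnorm; congr Num.sqrt; apply: eq_bigr => i _.
  by rewrite orthodiag_inv_coord mul1r exprMn.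
have normM : op_norm (@norm2 R m) (@norm2 R m) M = Num.sqrt (l 0 i0 ^+ 2).
  apply: (op_norm_wnorm QQ norm2_wnorm norm2_mul_wnorm (k := i0)) => // [i|];
    rewrite mulr1//.
  by rewrite lerXn2r ?nnegrE.
have normMV :
    op_norm (@norm2 R m) (@norm2 R m) (invmx M) = Num.sqrt ((l 0 i1)^-1 ^+ 2).
  apply: (op_norm_wnorm QQ norm2_wnorm MV2 (k := i1)) => // [i|]; rewrite mulr1//.
  by rewrite lerXn2r ?nnegrE ?invr_ge0// lef_pV2 ?posrE.
by rewrite /kappa2 /cond_num normM normMV !sqrtr_sqr !ger0_norm ?invr_ge0.
Qed.

(** Against the weights [l] of the energy norm, the weights [l ^+ 2] of
[M *m c] have ratio [l], and the weights [l ^-1] of [invmx M *m c] are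
themselves the ratios to the Euclidean norm: each factor of the condition number
is a square root of the corresponding factor of [kappa2 M]. *)
Lemma cond_num_energy_orthodiag (N : 'cV[R]_m -> R) :
  (forall c, N c = Num.sqrt ((c^T *m M *m c) 0 0)) ->
  cond_num N (@norm2 R m) M = Num.sqrt (l 0 i0 / l 0 i1).
Proof.
move=> NE; have {}NE c : N c = wnorm Q (l 0) c by rewrite NE energy_wnorm.
have MVN c : N (invmx M *m c) = wnorm Q (fun i => (l 0 i)^-1) c.
  rewrite NE; congr Num.sqrt; apply: eq_bigr => i _.
  by rewrite orthodiag_inv_coord; field; rewrite gt_eqF.
have normM : op_norm N (@norm2 R m) M = Num.sqrt (l 0 i0).
  apply: (op_norm_wnorm QQ NE norm2_mul_wnorm (k := i0)) => // i.
  by rewrite expr2 ler_wpM2r// ltW.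
have normMV : op_norm (@norm2 R m) N (invmx M) = Num.sqrt (l 0 i1)^-1.
  apply: (op_norm_wnorm QQ norm2_wnorm MVN (k := i1)) => // [i|]; rewrite mulr1//.
  by rewrite lef_pV2 ?posrE.
by rewrite /cond_num normM normMV sqrtrM// ltW.
Qed.

End SpectralCondition.

(** * The spectrum of the Bernstein mass matrix *)

(** The eigenvalue of the mass matrix whose eigenvector holds the Bernstein
coefficients of the shifted Legendre polynomial of degree [k]. *)
Definition mass_ev (R : realType) (n k : nat) : R :=
  (n`! ^ 2)%:R / ((n + k).+1`! * (n - k)`!)%:R.

Definition pascal_mx (R : realType) (n : nat) : 'M[R]_n.+1 :=
  \matrix_(i, j) 'C(i, j)%:R.

Lemma mass_ev_gt0 (R : realType) (n k : nat) : 0 < mass_ev R n k.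
Proof. by rewrite divr_gt0// ltr0n ?expn_gt0 ?muln_gt0 ?fact_gt0. Qed.

Lemma mass_ev_lt (R : realType) (n j k : nat) :
  (j < k <= n)%N -> mass_ev R n k < mass_ev R n j.
Proof.
case/andP; elim: k => // k IHk; rewrite ltnS => jk kn.
have step : mass_ev R n k.+1 < mass_ev R n k.
  rewrite /mass_ev ltr_pM2l ?ltr0n ?expn_gt0 ?fact_gt0//.
  rewrite ltf_pV2 ?posrE ?ltr0n ?muln_gt0 ?fact_gt0// ltr_nat.
  have [d dE] : exists d, (n - k = d.+1)%N by exists (n - k).-1; lia.
  rewrite addnS (factS (n + k).+1) dE (_ : n - k.+1 = d)%N; last by lia.
  rewrite (factS d) mulnCA -mulnA ltn_pmul2r ?muln_gt0 ?fact_gt0//; lia.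
move: jk; rewrite leq_eqVlt => /predU1P[->//|/IHk/(_ (ltnW kn))].
exact: lt_trans.
Qed.

(** The Bernstein form of a monomial: C(j, k) C(n, j) = C(n, k) C(n - k, j - k),
so the sum factors as C(n, k) x^k times the binomial expansion of
((1 - x) + x)^(n - k). *)
Lemma sum_bin_bernstein (R : realType) (n k : nat) (x : R) : (k <= n)%N ->
  \sum_(j < n.+1) 'C(j, k)%:R * bernstein n j x = 'C(n, k)%:R * x ^+ k.
Proof.
move=> kn; rewrite -(subnKC kn) -addnS big_split_ord /= big1 ?add0r => [|j _].
  set d := (n - k)%N.
  transitivity ('C(k + d, k)%:R * x ^+ k * (1 - x + x) ^+ d); last first.
    by rewrite subrK expr1n mulr1.
  rewrite exprDn mulr_sumr; apply: eq_bigr => j _.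
  have jd : (j <= d)%N by rewrite -ltnS.
  rewrite /bernstein subnDl -[X in _ = _ * X]mulr_natr.
  have -> : 'C(k + d, k)%:R * x ^+ k * ((1 - x) ^+ (d - j) * x ^+ j * 'C(d, j)%:R)
     = ('C(k + d, k) * 'C(d, j))%:R * (x ^+ k * x ^+ j) * (1 - x) ^+ (d - j).
    by rewrite natrM; ring.
  rewrite -exprD !mulrA -natrM; congr (_%:R * _ * _).
  (* both sides times k! j! (d - j)! are (k + d)! *)
  apply/eqP; rewrite -(eqn_pmul2r (fact_gt0 k)) -(eqn_pmul2r (fact_gt0 j)).
  rewrite -(eqn_pmul2r (fact_gt0 (d - j))); apply/eqP.
  have b1 := @bin_fact (k + j) k (leq_addr _ _).
  have b2 := @bin_fact (k + d) (k + j) ltac:(by rewrite leq_add2l).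
  have b3 := @bin_fact (k + d) k (leq_addr _ _).
  have b4 := @bin_fact d j jd.
  rewrite addKn in b1; rewrite subnDl in b2; rewrite addKn in b3.
  transitivity (k + d)`!; first by rewrite -b2 -b1; ring.
  by rewrite -b3 -b4; ring.
by rewrite bin_small// mul0r.
Qed.

Lemma continuous_bernstein (R : realType) (n i : nat) :
  continuous (@bernstein R n i).
Proof.
rewrite (_ : bernstein n i = fun x => 'C(n, i)%:R * XMonemX i (n - i) x).
  by move=> x; apply: cvgM; [exact: cvg_cst|exact: continuous_XMonemX].
by apply/funext => x; rewrite /bernstein /XMonemX /unstable.onem mulrA.
Qed.

Lemma integrable_bernsteinM (R : realType) (n i : nat) (f : R -> R) :
  continuous f ->
  (@lebesgue_measure R).-integrable `[0, 1]
    (EFin \o (fun x => bernstein n i x * f x)).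
Proof.
move=> cf; apply: continuous_compact_integrable; first exact: segment_compact.
apply: continuous_subspaceT => x; apply: cvgM; last exact: cf.
exact: continuous_bernstein.
Qed.

Lemma Rintegral_sum d (T : measurableType d) (R : realType)
    (mu : {measure set T -> \bar R}) (D : set T) (I : Type) (s : seq I)
    (f : I -> T -> R) :
  measurable D -> (forall i, mu.-integrable D (EFin \o f i)) ->
  \int[mu]_(x in D) (\sum_(i <- s) f i x) =
  \sum_(i <- s) \int[mu]_(x in D) f i x.
Proof.
move=> mD intf; elim: s => [|i s IHs].
  by under eq_Rintegral do rewrite big_nil; rewrite big_nil /Rintegral integral0.
under eq_Rintegral do rewrite big_cons.
rewrite big_cons RintegralD ?IHs//.
rewrite (_ : _ \o _ = fun x => (\sum_(j <- s) (f j x)%:E)%E).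
  by apply: integrable_sum => // j _; exact: intf.
by apply/funext => x; rewrite sumEFin.
Qed.

Lemma Rintegral_bernsteinX (R : realType) (n i k : nat) :
  (i <= n)%N -> (k <= n)%N ->
  \int[lebesgue_measure]_(x in `[0, 1]) (bernstein n i x * ('C(n, k)%:R * x ^+ k))
  = mass_ev R n k * 'C(i + k, k)%:R.
Proof.
move=> i_le k_le.
have -> : (fun x : R => bernstein n i x * ('C(n, k)%:R * x ^+ k)) =
    (fun x => ('C(n, i) * 'C(n, k))%:R * XMonemX (i + k) (n - i) x).
  apply/funext => x.
  by rewrite /bernstein /XMonemX /unstable.onem natrM exprD; ring.
rewrite RintegralZl//; last exact: integrable_XMonemX.
rewrite Rintegral_mkcond -[Rintegral _ _ _]/(beta_fun (i + k).+1 (n - i).+1).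
rewrite beta_fun_fact /mass_ev addnAC subnKC// mulrA -natrM mulrAC -natrM.
apply/eqP; rewrite eqr_div ?pnatr_eq0 -?lt0n ?muln_gt0 ?fact_gt0//.
rewrite -!natrM eqr_nat -(eqn_pmul2r (fact_gt0 i)) -(eqn_pmul2r (fact_gt0 k)).
apply/eqP.
have bni := bin_fact i_le; have bnk := bin_fact k_le.
have bik := bin_fact (leq_addl i k); rewrite addnK in bik.
transitivity ((i + k)`! * n`! ^ 2 * (n + k).+1`!)%N.
  by rewrite expnS expn1 -{1}bni -{1}bnk; ring.
by rewrite -bik; ring.
Qed.

Lemma sum_bin_sub (n i k : nat) : (k <= n)%N ->
  (\sum_(j < n.+1) 'C(k, j) * 'C(i, j) = 'C(i + k, k))%N.
Proof.
move=> kn; rewrite -binomial.Vandermonde.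
rewrite (big_ord_widen n.+1 (fun j => ('C(i, j) * 'C(k, k - j))%N)) ?ltnS//.
rewrite [RHS]big_mkcond; apply: eq_bigr => j _; rewrite ltnS mulnC.
by case: leqP => jk; [rewrite bin_sub | rewrite (bin_small jk) muln0].
Qed.

(** Row [k] of the transposed Pascal matrix holds the Bernstein coefficients of
C(n, k) x^k, so the left-hand side collects the inner products of these
monomials with the B_i; the sum over [j] can be taken inside the integral. *)
Lemma pascal_mass (R : realType) (n : nat) :
  (pascal_mx R n)^T *m mass_mx R n =
  diag_mx (\row_k mass_ev R n k) *m pascal_mx R n *m (pascal_mx R n)^T.
Proof.
apply/matrixP => k i; rewrite -mulmxA mul_diag_mx !mxE.
have [kn ik] : (k <= n)%N /\ (i <= n)%N by split; rewrite -ltnS.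
have cf (j : nat) : continuous (fun x : R => 'C(j, k)%:R * bernstein n j x).
  by move=> y; apply: cvgM; [exact: cvg_cst | exact: continuous_bernstein].
transitivity (\int[lebesgue_measure]_(x in `[0, 1])
    (\sum_(j < n.+1) bernstein n i x * ('C(j, k)%:R * bernstein n j x)) : R).
  rewrite Rintegral_sum// => [|j]; last exact: integrable_bernsteinM.
  apply: eq_bigr => j _; rewrite !mxE -RintegralZl//; last first.
    exact/integrable_bernsteinM/continuous_bernstein.
  by apply: eq_Rintegral => x _; ring.
under eq_Rintegral do rewrite -mulr_sumr sum_bin_bernstein//.
rewrite Rintegral_bernsteinX//; congr (_ * _).
rewrite -(sum_bin_sub i kn) natr_sum; apply: eq_bigr => j _.
by rewrite !mxE natrM.
Qed.

Lemma pascal_unit (R : realType) (n : nat) : pascal_mx R n \in unitmx.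
Proof.
rewrite unitmxE det_trig; last first.
  by apply/is_trig_mxP => i j ij; rewrite mxE bin_small.
by rewrite big1 ?unitr1// => i _; rewrite mxE binn.
Qed.

(** By [pascal_mass], conjugating with the transposed Pascal matrix turns the
mass matrix into the triangular matrix [diag_mx _ *m pascal_mx R n], and the
roots of the characteristic polynomial are on its diagonal. *)
Lemma mass_mx_eigenvalue (R : realType) (n : nat) (k : 'I_n.+1) :
  eigenvalue (mass_mx R n) (mass_ev R n k).
Proof.
set P := pascal_mx R n.
have Pu : P^T \in unitmx by rewrite unitmx_tr pascal_unit.
apply: (@eigenvalue_conjmx _ _ _ P^T); rewrite ?stablemx_unit ?row_free_unit//.
rewrite conjumx// pascal_mass mulmxK//.
rewrite -[_ \in _]/(eigenvalue _ _) eigenvalue_root_char.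
rewrite char_poly_trig; last first.
  by apply/is_trig_mxP => i j ij; rewrite mul_diag_mx !mxE bin_small// mulr0.
rewrite /root horner_prod; apply/prodf_eq0; exists k => //.
by rewrite mul_diag_mx !mxE binn mulr1 !hornerE subrr.
Qed.

(** * The condition numbers *)

Theorem theorem5p1 (R : realType) (n : nat) :
  kappa_mass2 (mass_mx R n) = Num.sqrt (kappa2 (mass_mx R n)) /\
  Num.sqrt (kappa2 (mass_mx R n)) =
    Num.sqrt ((2 * n + 1)`!%:R / ((n + 1)`!%:R * n`!%:R)).
Proof.
pose l : 'rV[R]_n.+1 := \row_k mass_ev R n k.
have l_gt0 i : 0 < l 0 i by rewrite mxE mass_ev_gt0.
have l_lt (i j : 'I_n.+1) : (i < j)%N -> l 0 j < l 0 i.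
  by move=> ij; rewrite !mxE mass_ev_lt// ij -ltnS ltn_ord.
have l_le (i j : 'I_n.+1) : (i <= j)%N -> l 0 j <= l 0 i.
  by rewrite leq_eqVlt => /predU1P[/val_inj->//|/l_lt/ltW].
have l_inj : injective (l 0).
  move=> i j lij; apply/val_inj/eqP; rewrite eqn_leq.
  by apply/andP; split; rewrite leqNgt; apply/negP => /l_lt; rewrite lij ltxx.
have Msym : (mass_mx R n)^T = mass_mx R n.
  apply/matrixP => i j; rewrite !mxE.
  by apply: eq_Rintegral => x _; rewrite mulrC.
have Mev i : eigenvalue (mass_mx R n) (l 0 i) by rewrite mxE mass_mx_eigenvalue.
have [Q QQ ME] := sym_orthodiag Msym l_inj Mev.
have l_max i : l 0 i <= l 0 ord0 by exact: l_le.
have l_min i : l 0 ord_max <= l 0 i by apply: l_le; rewrite -ltnS.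
have kE := kappa2_orthodiag QQ ME l_gt0 l_max l_min.
split.
  by rewrite kE; exact: (cond_num_energy_orthodiag QQ ME l_gt0 l_max l_min).
rewrite kE; congr Num.sqrt; rewrite !mxE /mass_ev /= subn0 addn0 subnn.
have f_neq0 m : m`!%:R != 0 :> R by rewrite pnatr_eq0 -lt0n fact_gt0.
rewrite addn1 mul2n -addnn addn1 fact0 muln1.
(* abstracting the factorials keeps the next steps from unfolding them *)
move: (f_neq0 n) (f_neq0 n.+1) (f_neq0 (n + n).+1).
move: n`! n.+1`! (n + n).+1`! => a b c a0 b0 c0.
by rewrite natrX natrM; field; rewrite a0 b0 c0.
Qed.
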